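(* Let $\theta:\mathbb N\to\mathcal P(\mathcal P(\mathbb N))$. For all $z\in\mathbb N$ and $p\subseteq\mathbb N$, we have $z\in\mathrm{lo}'_\theta(p)$ if and only if there is a $(z,\theta,p)$-dedicated sight.
   Context: Write $e(n)$ for the (possibly undefined) value at $n$ of the $e$-th partial recursive function and $\langle\cdot,\cdot\rangle$ for a fixed recursive bijective pairing on $\mathbb N$. $\mathcal P(X)$ is the power set. For $A,B\subseteq\mathbb N$: $A\wedge B=\{\langle a,b\rangle : a\in A,b\in B\}$ and $A\Rightarrow B=\{e : \text{for all }a\in A,\ e(a)\text{ is defined and }e(a)\in B\}$. For $\theta:\mathbb N\to\mathcal P(\mathcal P(\mathbb N))$ and $p\subseteq\mathbb N$: $\mathrm{mo}_\theta(p)=\{\langle n,e\rangle : \exists A\in\theta(n),\ e\in(A\Rightarrow p)\}$, and $\mathrm{lo}'_\theta(p)=\bigcap\{q\subseteq\mathbb N : \{0\}\wedge p\subseteq q\text{ and }\{1\}\wedge\mathrm{mo}_\theta(q)\subseteq q\}$. A sight is, inductively, either an object called $\mathrm{Nil}$, or a pair $(A,\sigma)$ where $A\subseteq\mathbb N$ and $\sigma$ assigns to each $a\in A$ a sight $\sigma(a)$. For $z\in\mathbb N$, $\theta:\mathbb N\to\mathcal P(\mathcal P(\mathbb N))$ and $p\subseteq\mathbb N$, a sight $S$ is $(z,\theta,p)$-dedicated if, by induction on $S$: in case $S=\mathrm{Nil}$, $z=\langle0,y\rangle$ with $y\in p$; in case $S=(A,\sigma)$, (i) $z=\langle1,\langle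 n,e\rangle\rangle$ for some $n,e\in\mathbb N$, (ii) $A\in\theta(n)$, (iii) $e(a)$ is defined for all $a\in A$, and (iv) for each $a\in A$ the sight $\sigma(a)$ is $(e(a),\theta,p)$-dedicated. *)

(* Defs.v *)
From mathcomp Require Import all_boot.
From mathcomp Require Import boolp classical_sets.
From Stdlib Require Cantor.

Set Implicit Arguments.
Unset Strict Implicit.
Unset Printing Implicit Defensive.

Local Open Scope classical_set_scope.

Definition npair (m n : nat) : nat := Cantor.to_nat (m, n).

Lemma npair_inj m n m' n' : npair m n = npair m' n' -> m = m' /\ n = n'.
Proof. by move=> /Cantor.to_nat_inj [-> ->]. Qed.

Lemma npair_surj z : exists m n, z = npair m n.
Proof.
exists (Cantor.of_nat z).1, (Cantor.of_nat z).2.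
by rewrite /npair -surjective_pairing Cantor.cancel_to_of.
Qed.

(* Kleene's schemes for the partial recursive functions of [n] arguments. *)
Inductive prf : nat -> Type :=
| Zero n : prf n
| Succ : prf 1
| Proj n (i : 'I_n) : prf n
| Comp k n (f : prf k) (g : 'I_k -> prf n) : prf n
| PrimRec n (f : prf n) (g : prf n.+2) : prf n.+1
| Mu n (f : prf n.+1) : prf n.

(* [eval c v y]: the function presented by [c] is defined at [v], with value
   [y].  Recursion and minimization act on the first argument, and in [Mu] all
   values before the least zero must be defined. *)
Fixpoint eval n (c : prf n) : n.-tuple nat -> nat -> Prop :=
  match c in prf n return n.-tuple nat -> nat -> Prop with
  | Zero _ => fun _ y => y = 0
  | Succ => fun v y => y = (thead v).+1
  | Proj _ i => fun v y => y = tnth v i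
  | Comp k _ f g => fun v y =>
      exists w : k.-tuple nat,
        (forall i, eval (g i) v (tnth w i)) /\ eval f w y
  | PrimRec _ f g => fun v =>
      let u := [tuple of behead v] in
      (fix rec (x : nat) : nat -> Prop :=
         match x with
         | 0 => eval f u
         | x'.+1 => fun y =>
             exists r, rec x' r /\ eval g [tuple of x' :: r :: u] y
         end) (thead v)
  | Mu _ f => fun v y =>
      eval f [tuple of y :: v] 0 /\
      forall j, j < y -> exists r, eval f [tuple of j :: v] r.+1
  end.

Definition seq_code (s : seq nat) : nat :=
  foldr (fun x l => (npair x l).+1) 0 s.

Fixpoint code n (c : prf n) : nat :=
  match c with
  | Zero _ => npair 0 0
  | Succ => npair 1 0
  | Proj _ i => npair 2 i
  | Comp k _ f g =>
      npair 3 (npair k (npair (code f)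
        (seq_code [seq code (g i) | i <- enum 'I_k])))
  | PrimRec _ f g => npair 4 (npair (code f) (code g))
  | Mu _ f => npair 5 (code f)
  end.

(* [pr_app e n m]: e(n) is defined and equal to m.  An [e] which is not the
   code of a presentation of a unary function indexes the nowhere defined
   function. *)
Definition pr_app (e n m : nat) : Prop :=
  exists2 c : prf 1, code c = e & eval c [tuple n] m.

Lemma eval_fun n (c : prf n) v y y' : eval c v y -> eval c v y' -> y = y'.
Proof.
elim: c v y y' => {n} /= [n|| n i|k n f IHf g IHg|n f IHf g IHg|n f IHf] v y y'.
- by move=> -> ->.
- by move=> -> ->.
- by move=> -> ->.
- move=> [w [gw fw]] [w' [gw' fw']].
  have eww' : w = w' by apply: eq_from_tnth => i; apply: IHg (gw i) (gw' i).
  by move: fw'; rewrite -eww'; apply: IHf fw.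
- elim: (thead v) y y' => [|x IHx] y y'; first exact: IHf.
  move=> [r [xr gr]] [r' [xr' gr']].
  by move: gr'; rewrite -(IHx _ _ xr xr'); apply: IHg gr.
- move=> [fy lty] [fy' lty']; case: (ltngtP y y') => // lt.
  + by have [r fr] := lty' _ lt; have := IHf _ _ _ fy fr.
  + by have [r fr] := lty _ lt; have := IHf _ _ _ fy' fr.
Qed.

Lemma seq_code_inj : injective seq_code.
Proof.
elim=> [|x s IHs] [|x' s'] //=.
by move=> [] /npair_inj [-> /IHs ->].
Qed.

Lemma eval_code n (c : prf n) n' (c' : prf n') (v : n.-tuple nat)
    (v' : n'.-tuple nat) y :
  n = n' -> code c = code c' -> val v = val v' -> eval c v y -> eval c' v' y.
Proof.
elim: c n' c' v v' y =>
    {n} [n|| n i|k n f IHf g IHg|n f IHf g IHg|n f IHf] n' c' v v' y.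
- by case: c' v' => [m|| m j|l m f' g'|m f' g'|m f'] v' nm /npair_inj [] //.
- case: c' v' => [m|| m j|l m f' g'|m f' g'|m f'] v' nm /npair_inj [] // _ _.
  by move=> /val_inj ->.
- case: c' v' => [m|| m j|l m f' g'|m f' g'|m f'] v' nm /npair_inj [] // _ ij.
  by move=> /= vv' ->; rewrite !(tnth_nth 0) /= vv' ij.
- case: c' v' => [m|| m j|l m f' g'|m f' g'|m f'] v' nm /npair_inj [] // _.
  move=> /npair_inj [kl /npair_inj [ff' /seq_code_inj gg']] vv'.
  move: f' g' ff' gg'; rewrite -{l}kl => f' g' ff' gg' [w [gw fw]].
  exists w; split; last exact: IHf ff' _ fw.
  move=> i; apply: IHg (gw i) => //.
  by move/eq_in_map: gg'; apply; rewrite mem_enum.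
- case: c' v' => [m|| m j|l m f' g'|m f' g'|m f'] v' nm /npair_inj [] // _.
  move=> /npair_inj [ff' gg'] vv' /=.
  have -> : thead v' = thead v by rewrite /thead !(tnth_nth 0) /= vv'.
  case: nm => nm.
  elim: (thead v) y => [|x IHx] y.
    by apply: IHf => //=; rewrite vv'.
  move=> [r [xr gr]]; exists r; split; first exact: IHx.
  by apply: IHg gr => //=; rewrite ?nm ?vv'.
- case: c' v' => [m|| m j|l m f' g'|m f' g'|m f'] v' nm /npair_inj [] // _.
  move=> ff' vv' /= [fy lty]; split.
    by apply: IHf fy => //=; rewrite ?nm ?vv'.
  move=> j /lty [r fr]; exists r.
  by apply: IHf fr => //=; rewrite ?nm ?vv'.
Qed.

Lemma pr_app_fun e n m m' : pr_app e n m -> pr_app e n m' -> m = m'.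
Proof.
move=> [c ce cm] [c' ce' cm'].
by apply: eval_fun (eval_code _ _ _ cm) cm' => //; rewrite ce ce'.
Qed.

Definition conj_set (A B : set nat) : set nat :=
  [set z | exists a b, [/\ A a, B b & z = npair a b]].

Definition impl_set (A B : set nat) : set nat :=
  [set e | forall a, A a -> exists2 b, pr_app e a b & B b].

Definition mo (theta : nat -> set (set nat)) (p : set nat) : set nat :=
  [set z | exists n e, z = npair n e /\
     exists2 A, theta n A & impl_set A p e].

Definition lo' (theta : nat -> set (set nat)) (p : set nat) : set nat :=
  \bigcap_(q in [set q : set nat | conj_set [set 0] p `<=` q /\
                   conj_set [set 1] (mo theta q) `<=` q]) q.

Inductive sight : Type :=
| SNil
| SNode (A : set nat) (sigma : {a : nat | A a} -> sight).

(* Since [pr_app] is single-valued, the last two clauses for [SNode] say that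
   e(a) is defined for all a in A and that [sigma a] is dedicated for the
   number e(a). *)
Fixpoint dedicated (z : nat) (theta : nat -> set (set nat)) (p : set nat)
    (S : sight) : Prop :=
  match S with
  | SNil => exists2 y, p y & z = npair 0 y
  | SNode A sigma => exists n e,
      [/\ z = npair 1 (npair n e),
          theta n A,
          forall a, A a -> exists w, pr_app e a w
        & forall (a : {a : nat | A a}) w,
            pr_app e (proj1_sig a) w -> dedicated w theta p (sigma a)]
  end.

(* Main.v *)
(* The numbers admitting a dedicated sight form the least set closed under the
   two clauses defining lo': the node clause glues chosen sights, and
   induction on a sight puts its number in every closed set. *)
Require Import Defs.
From mathcomp Require Import all_boot.
From mathcomp Require Import boolp classical_sets.

Lemma mo_dedicated (theta : nat -> set (set nat)) (p : set nat) (z : nat) :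
  mo theta (fun w => exists S, dedicated w theta p S) z ->
  exists S, dedicated (npair 1 z) theta p S.
Proof.
move=> [n [e [-> [A thA eA]]]].
(* [S] is chosen before [w], so that [choice] yields a function of [a] alone; as [pr_app] is
   single-valued, the sight for [b] serves every [w]. *)
have sightP (a : {a : nat | A a}) : exists S, forall w,
    pr_app e (proj1_sig a) w -> dedicated w theta p S.
  have [b eb [S dS]] := eA _ (proj2_sig a).
  by exists S => w ew; rewrite (pr_app_fun ew eb).
have [sigma sigmaP] := choice sightP.
exists (SNode sigma), n, e; split=> // a /eA[b eb _].
by exists b.
Qed.

Lemma dedicated_lo' (theta : nat -> set (set nat)) (p : set nat) (S : sight)
    (z : nat) : dedicated z theta p S -> lo' theta p z.
Proof.
move=> + q [q0 q1].
(* [q] stays fixed while [z] varies: the subsights are dedicated for the values e(a). *)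
elim: S z => [|A sigma IH] z /=.
  by move=> [y py ->]; apply: q0; exists 0, y.
move=> [n [e [-> thA eA dsigma]]].
apply: q1; exists 1, (npair n e); split=> //.
exists n, e; split=> //; exists A => // a Aa.
have [w ew] := eA _ Aa.
by exists w => //; apply: (IH (exist _ a Aa)); apply: dsigma.
Qed.

Theorem proposition3p2p4 (theta : nat -> set (set nat)) (z : nat) (p : set nat) :
  lo' theta p z <-> exists S : sight, dedicated z theta p S.
Proof.
split=> [|[S]]; last exact: dedicated_lo'.
move=> /(_ (fun w => exists S, dedicated w theta p S)).
(* Both closure conditions concern tagged pairs: tag 0 calls for [SNil], tag 1 for a node. *)
apply; split=> _ [_ [b [-> + ->]]].
  by move=> pb; exists SNil, b.
exact: mo_dedicated.
Qed.
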